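(* Let $m\ge1$ be an integer, let $a$ be real, and let $F_m$ be a real polynomial of degree $m$ with $F_m(0)=1$ whose zeros are $-\alpha_1,\ldots,-\alpha_m$ (repeated according to multiplicity). Suppose $a+m<1$ and $\alpha_j>0$ for $j=1,\ldots,m$. Then all zeros of the $F_m$-Eulerian polynomial $\hat{w}(a;F_m\,|\,x)$ or, equivalently, of the hypergeometric function $\sum_{n\ge0}F_m(n)\frac{(a)_n}{n!}x^n$, are real and lie in the interval $(0,1)$. If (still with $\alpha_j>0$ for $j=1,\ldots,m$) $1\le a+m<2$, then all zeros but one lie in $(0,1)$, plus one zero lies in $[1,\infty)$.
   Context: $(a)_n=a(a+1)\cdots(a+n-1)$, $(a)_0=1$, is the Pochhammer symbol. For real $a$ and a polynomial $F_m$ of degree $m$ with $F_m(0)=1$, the $F_m$-Eulerian polynomial $\hat{w}(x)=\hat{w}(a;F_m\,|\,x)$ is the polynomial in $x$ of degree at most $m$ defined by $$\sum_{n=0}^{\infty}F_m(n)\frac{(a)_n}{n!}x^n=\frac{\hat{w}(a;F_m\,|\,x)}{(1-x)^{m+a}},$$ where powers of $1-x$ are understood as power series at $0$. The left-hand side is a generalized hypergeometric function: writing $F_m(t)=\prod_{i=1}^r (f_i+t)_{m_i}/(f_i)_{m_i}$ with positive integers $m_i$, $m_1+\cdots+m_r=m$, it equals ${}_{r+1}F_r$ with top parameters $a,f_1+m_1,\ldots,f_r+m_r$ and bottom parameters $f_1,\ldots,f_r$. Zeros are counted with multiplicity.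
   Formalization: For 1≤a+m<2 with m=1 it is also assumed that a<α_1 (false otherwise: a=1/2, α_1=1/4 gives ŵ=1+x); zeros of the hypergeometric function are those of its analytic continuation away from x=1, where the equivalence with ŵ can fail. *)

(* Defs.v *)
From mathcomp Require Import all_boot all_order all_algebra.
From mathcomp Require Import complex.
From mathcomp Require Import all_classical all_reals all_analysis.

Set Implicit Arguments.
Unset Strict Implicit.
Unset Printing Implicit Defensive.

Import Order.TTheory GRing.Theory Num.Theory.
Import numFieldNormedType.Exports.

Local Open Scope classical_set_scope.
Local Open Scope complex_scope.
Local Open Scope ring_scope.

(* The multiset of zeros of a nonzero polynomial, as a sequence: over a field
   that is not algebraically closed this also asserts that [p] splits. *)
Definition zeros_of (K : idomainType) (p : {poly K}) (zs : seq K) : Prop :=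
  p != 0 /\ p = lead_coef p *: \prod_(z <- zs) ('X - z%:P).

Definition poch (R : pzRingType) (a : R) (n : nat) : R :=
  \prod_(i < n) (a + i%:R).

(* The coefficient of x^n in the binomial series
   (1 - x)^(-s) = \sum_n (s)_n / n! x^n. *)
Definition binser (R : fieldType) (s : R) (n : nat) : R :=
  poch s n / n`!%:R.

Definition hyper_coef (R : fieldType) (a : R) (F : {poly R}) (n : nat) : R :=
  F.[n%:R] * (poch a n / n`!%:R).

(* [w] is the F-Eulerian polynomial with parameter [a] and [m] the degree of
   [F]: the identity
     \sum_n F(n) (a)_n / n! x^n = w(x) (1 - x)^(- (m + a))
   is one of formal power series, stated coefficientwise. *)
Definition eulerian (R : fieldType) (m : nat) (a : R) (F w : {poly R}) : Prop :=
  (size w <= m.+1)%N /\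
  forall n : nat,
    hyper_coef a F n = \sum_(k < n.+1) w`_k * binser (m%:R + a) (n - k).

Section Analytic.
Variable R : realType.
(* [R[i]] has no topology of its own; its regular module [R[i]^o] does. *)
Local Notation C := (R[i])^o.

Definition has_expansion (H : C -> C) (z : C) (c : nat -> C) : Prop :=
  \forall x \near z, series (fun n => c n * (x - z) ^+ n) @ \oo --> H x.

Definition analytic_at (H : C -> C) (z : C) : Prop :=
  exists c : nat -> C, has_expansion H z c.

(* [k = 0] means that [H] is analytic at [z] and does not vanish there. *)
Definition zero_order (H : C -> C) (z : C) (k : nat) : Prop :=
  exists c : nat -> C,
    [/\ has_expansion H z c, forall j, (j < k)%N -> c j = 0 & c k != 0].

(* The zeros of [H] in [D], counted with multiplicity, are the members of [zs]
   that lie in [D]. *)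
Definition zeros_in (D : set C) (H : C -> C) (zs : seq C) : Prop :=
  forall z, D z -> zero_order H z (count_mem z zs).

(* [H] is a single-valued branch, on the domain [D], of the analytic
   continuation of \sum_n F(n) (a)_n / n! x^n. The branch point [1] of the
   function is excluded; typical domains are the unit disc and the plane cut
   along a curve from [1] to infinity, such as [1, +oo[. *)
Definition hyper_branch (a : R) (F : {poly R}) (D : set C) (H : C -> C) : Prop :=
  [/\ open D, connected D, D 0 /\ ~ D 1,
      forall z, D z -> analytic_at H z &
      has_expansion H 0 (fun n => (hyper_coef a F n)%:C)].

End Analytic.

(* Main.v *)
Require Import Defs.
From mathcomp Require Import all_boot all_order all_algebra.
From mathcomp Require Import complex polyrcf ring lra.
From mathcomp Require Import all_classical all_reals all_analysis.

(** Write [s_k = k + a] and [F_(k+1) = (1 + b X) F_k] with [b = 1 / alpha > 0].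
    Multiplying the [n]-th coefficient of a series by [1 + b n] is applying
    [1 + b x d/dx], so the Eulerian polynomials of [F_k] and [F_(k+1)] satisfy
<<
    w_(k+1) = (1 - X) w_k + b X ((1 - X) w_k' + s_k w_k),
>>
    whence [w_(k+1)(0) = w_k(0) = 1], [w_(k+1)(1) = b s_k w_k(1)], and
    [w_(k+1)(r) = b r (1 - r) w_k'(r)] at a root [r] of [w_k]. If [w_k] has [k]
    simple roots in [(0, 1)] and [s_k < 0], the signs of [w_(k+1)] therefore
    alternate along [0], the roots of [w_k], and [1]; this gives [k + 1] roots
    in [(0, 1)], which are all the roots since [w_(k+1)] has degree at most
    [k + 1] ([real_simple_01_step]). When [a + m < 1], every [s_k] with [k < m]
    is negative. When [1 <= a + m < 2], only the last one, [s_(m-1)], is not: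
    the last step still gives [m - 1] roots in [(0, 1)]. In that step the
    leading coefficient is multiplied by [b a - 1], a negative number by
    hypothesis if [m = 1] and because [a < 0] if [m >= 2]; the signs of the
    leading coefficient and at [1] put the remaining root in [[1, +oo)]
    ([real_simple_01_last_step]). The polynomial so
    constructed is [w], as the generating identity determines the numerator
    ([eulerian_uniq]).

    For the analytic continuations [H] of the hypergeometric series, the
    function [w(x) (1 - x)^(- s)], with [s = m + a], solves
<<
    (1 - x) w H' = ((1 - x) w' + s w) H.
>>
    The difference of the two sides is analytic on the domain and vanishes near
    [0], hence everywhere ([identity_theorem]). At a point [z <> 1] where
    [w] has a zero of order [k], the lowest-order term of the equation forces the
    expansion of [H], which is nonzero by the identity theorem, to have order
    exactly [k] ([ode_order], [continuation_order]). Thus neither a logarithm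
    nor a branch of [(1 - x)^(- s)] has to be constructed. *)

Import Order.TTheory GRing.Theory Num.Theory.
Import numFieldNormedType.Exports.

Local Open Scope classical_set_scope.
Local Open Scope complex_scope.
Local Open Scope ring_scope.

Set Implicit Arguments.
Unset Strict Implicit.

(** * Formal power series and polynomial factors *)

Section FormalSeries.
Variable K : comNzRingType.
Implicit Types (p q : {poly K}) (c d : nat -> K).

(** Formal power series are sequences of coefficients. [trunc N c] is the
    polynomial of the first [N] terms, [pmul p c] the product of the series [c]
    by the polynomial [p], and [dser c] the derivative of [c]. *)
Definition trunc (N : nat) c : {poly K} := \poly_(i < N) c i.

Definition pmul p c (n : nat) : K := \sum_(i < n.+1) p`_i * c (n - i)%N.

Definition dser c (n : nat) : K := n.+1%:R * c n.+1.

Lemma coef_trunc N c n : (n < N)%N -> (trunc N c)`_n = c n.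
Proof. by move=> nN; rewrite coef_poly nN. Qed.

Lemma coef_mul_agree p q1 q2 n :
  (forall i, (i <= n)%N -> q1`_i = q2`_i) -> (p * q1)`_n = (p * q2)`_n.
Proof.
move=> e; rewrite !coefM; apply: eq_bigr => i _.
by rewrite e // leq_subr.
Qed.

Lemma pmulE N p c n : (n < N)%N -> pmul p c n = (p * trunc N c)`_n.
Proof.
move=> nN; rewrite coefM; apply: eq_bigr => i _.
by rewrite coef_trunc // (leq_ltn_trans (leq_subr _ _)).
Qed.

Lemma eq_pmul p c d : c =1 d -> pmul p c =1 pmul p d.
Proof. by move=> e n; apply: eq_bigr => i _; rewrite e. Qed.

Lemma pmulA p q c n : pmul p (pmul q c) n = pmul (p * q) c n.
Proof.
rewrite !(@pmulE n.+1) // -mulrA; apply: coef_mul_agree => i ni.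
by rewrite coef_trunc // (@pmulE n.+1).
Qed.

Lemma pmulDl p q c n : pmul (p + q) c n = pmul p c n + pmul q c n.
Proof. by rewrite !(@pmulE n.+1) // mulrDl coefD. Qed.

Lemma pmulBl p q c n : pmul (p - q) c n = pmul p c n - pmul q c n.
Proof. by rewrite !(@pmulE n.+1) // mulrBl coefB. Qed.

Lemma pmulDr p c d n : pmul p (c \+ d) n = pmul p c n + pmul p d n.
Proof.
by rewrite /pmul -big_split; apply: eq_bigr => i _; rewrite /= mulrDr.
Qed.

Lemma pmulZl k p c n : pmul (k *: p) c n = k * pmul p c n.
Proof. by rewrite !(@pmulE n.+1) // -scalerAl coefZ. Qed.

Lemma pmulZr p k c n : pmul p (fun i => k * c i) n = k * pmul p c n.
Proof. by rewrite /pmul mulr_sumr; apply: eq_bigr => i _; rewrite mulrCA. Qed.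

Lemma pmul1 c : pmul 1 c =1 c.
Proof. by move=> n; rewrite (@pmulE n.+1) // mul1r coef_trunc. Qed.

Lemma pmulX0 c : pmul 'X c 0%N = 0.
Proof. by rewrite (@pmulE 1) // coefXM. Qed.

Lemma pmulXS c n : pmul 'X c n.+1 = c n.
Proof. by rewrite (@pmulE n.+2) // coefXM /= coef_trunc. Qed.

Lemma coef_deriv_trunc N c n : (n.+1 < N)%N -> (trunc N c)^`()`_n = dser c n.
Proof. by move=> nN; rewrite coef_deriv coef_trunc // /dser mulr_natl. Qed.

Lemma dser_pmul p c n : dser (pmul p c) n = pmul p^`() c n + pmul p (dser c) n.
Proof.
rewrite /dser (@pmulE n.+2) // mulr_natl -coef_deriv derivM coefD.
rewrite (@pmulE n.+2) //; congr (_ + _).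
rewrite (@pmulE n.+1) //; apply: coef_mul_agree => i ni.
by rewrite coef_deriv_trunc // coef_trunc.
Qed.

(** A series [w * b], where [w] is a polynomial and [(1 - X) b' = s b], solves
    the first-order linear equation obtained by eliminating [b]. *)
Lemma pmul_ode (s : K) w b :
    (forall n, pmul (1 - 'X) (dser b) n = s * b n) ->
  forall n, pmul ((1 - 'X) * w) (dser (pmul w b)) n
          = pmul ((1 - 'X) * w^`() + s *: w) (pmul w b) n.
Proof.
move=> hb n; rewrite (eq_pmul _ (dser_pmul w b)) pmulDr !pmulA.
have -> : (1 - 'X) * w * w = w ^+ 2 * (1 - 'X) by ring.
rewrite -(pmulA _ _ (dser b)) (eq_pmul _ hb) pmulZr -pmulZl -pmulDl.
congr (pmul _ _ _).
by rewrite -!mul_polyC; ring.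
Qed.

End FormalSeries.

(** * A recurrence for the Eulerian polynomials *)

Section Eulerian.
Variable R : numFieldType.
Implicit Types (a s : R) (F w : {poly R}).

Lemma pochS a n : poch a n.+1 = poch a n * (a + n%:R).
Proof. by rewrite /poch big_ord_recr. Qed.

Lemma binser0 s : binser s 0 = 1.
Proof. by rewrite /binser /poch big_ord0 fact0 invr1 mulr1. Qed.

Lemma binserS s n : n.+1%:R * binser s n.+1 = (s + n%:R) * binser s n.
Proof.
rewrite /binser pochS factS natrM.
have h1 : n.+1%:R != 0 :> R by rewrite pnatr_eq0.
have h2 : n`!%:R != 0 :> R by rewrite pnatr_eq0 -lt0n fact_gt0.
by move: (_.+1%:R) (_`!%:R) h1 h2 => x y hx hy; field; rewrite hx hy.
Qed.

Lemma pmul_1BX (c : nat -> R) n :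
  pmul (1 - 'X) c n = c n - (if n is k.+1 then c k else 0).
Proof. by rewrite pmulBl pmul1; case: n => [|n]; rewrite ?pmulX0 ?pmulXS. Qed.

Lemma binser_ode s n : pmul (1 - 'X) (dser (binser s)) n = s * binser s n.
Proof.
rewrite pmul_1BX; case: n => [|n].
  by rewrite /dser binserS addr0 subr0.
by rewrite /dser (binserS s n.+1); ring.
Qed.

Lemma poch_shift s n : s * poch (s + 1) n = poch s n.+1.
Proof.
rewrite /poch big_ord_recl addr0; congr (_ * _); apply: eq_bigr => i _.
by rewrite lift0 -natr1; ring.
Qed.

Lemma dser_binser s n : dser (binser s) n = s * binser (s + 1) n.
Proof.
have h1 : n.+1%:R != 0 :> R by rewrite pnatr_eq0.
have h2 : n`!%:R != 0 :> R by rewrite pnatr_eq0 -lt0n fact_gt0.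
rewrite /dser /binser mulrA -poch_shift factS natrM.
by move: (_.+1%:R) (_`!%:R) h1 h2 => x y hx hy; field; rewrite hx hy.
Qed.

(** [(1 - X)^(- s) = (1 - X) (1 - X)^(- (s + 1))]. *)
Lemma binser_shift s : binser s =1 pmul (1 - 'X) (binser (s + 1)).
Proof.
move=> n; rewrite pmul_1BX; case: n => [|n]; first by rewrite !binser0 subr0.
have h1 : n.+1%:R != 0 :> R by rewrite pnatr_eq0.
apply: (mulfI h1); rewrite mulrBr (binserS (s + 1)) [LHS](dser_binser s n).
by rewrite -natr1; ring.
Qed.

(** The passage from [F] to [(1 + b X) F]: since [n c_n] are the coefficients of
    [x C'(x)], it acts on generating functions as [1 + b x d/dx], and this is
    the effect on the numerator of [w(x) (1 - x)^(- s)]. *)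
Definition eulerian_step s (b : R) w : {poly R} :=
  (1 - 'X) * w + b *: ('X * ((1 - 'X) * w^`() + s *: w)).

Lemma size_eulerian_step s b w m :
  (size w <= m)%N -> (size (eulerian_step s b w) <= m.+1)%N.
Proof.
move=> sw.
have sz (p : {poly R}) k :
    (size p <= k)%N -> (size (((1 - 'X) : {poly R}) * p)%R <= k.+1)%N.
  move=> sp; apply: (leq_trans (size_polyMleq _ _)).
  rewrite -[1 - 'X]opprB size_polyN size_XsubC.
  by rewrite add2n /= ltnS.
have sd : (size w^`() <= m.-1)%N.
  by apply: (leq_trans (size_poly _ _)); rewrite -!subn1 leq_sub2r.
rewrite /eulerian_step; apply: (leq_trans (size_polyD _ _)).
rewrite geq_max sz //=; apply: (leq_trans (size_scale_leq _ _)).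
apply: (leq_trans (size_polyMleq _ _)); rewrite size_polyX add2n /= ltnS.
apply: (leq_trans (size_polyD _ _)).
rewrite geq_max (leq_trans (size_scale_leq _ _) sw) andbT.
case: m sw sd => [|m] sw sd; last exact: sz.
by move: sw; rewrite size_poly_leq0 => /eqP ->; rewrite deriv0 mulr0 size_poly0.
Qed.

Lemma eulerian_stepP m a b F w : eulerian m a F w ->
  eulerian m.+1 a ((1 + b *: 'X) * F) (eulerian_step (m%:R + a) b w).
Proof.
set s := m%:R + a => -[sw hw]; have s1 : m.+1%:R + a = s + 1.
  by rewrite /s -natr1; ring.
split; last first.
- have hwE n : hyper_coef a F n = pmul w (binser s) n by exact: hw.
  move=> n; rewrite -/(pmul _ (binser _) n) s1.
  have -> : hyper_coef a ((1 + b *: 'X) * F) n =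
      pmul w (binser s) n + b * (n%:R * pmul w (binser s) n).
    by rewrite -hwE /hyper_coef hornerM !hornerD hornerZ hornerX hornerC; ring.
  rewrite pmulDl pmulZl; congr (_ + b * _).
    by rewrite mulrC -pmulA; apply: eq_pmul; exact: binser_shift.
  case: n => [|n]; first by rewrite mul0r -pmulA pmulX0.
  rewrite -pmulA pmulXS -/(dser _ n) dser_pmul pmulDl pmulZl; congr (_ + _).
    by rewrite mulrC -pmulA; apply: eq_pmul; exact: binser_shift.
  rewrite -pmulZr; apply: eq_pmul => {}n.
  by rewrite dser_binser.
- exact: size_eulerian_step.
Qed.

(** The generating identity determines the numerator, as the system for its
    coefficients is triangular with diagonal entries [1]. *)
Lemma eulerian_uniq m a F w1 w2 :
  eulerian m a F w1 -> eulerian m a F w2 -> w1 = w2.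
Proof.
move=> [_ h1] [_ h2]; apply/polyP => n.
elim/ltn_ind: n => n IH.
have := h1 n; rewrite h2 !big_ord_recr /= subnn binser0 !mulr1.
under eq_bigr do rewrite -IH //.
by move/addrI.
Qed.

Lemma eulerian0 a : eulerian 0 a 1 (1 : {poly R}).
Proof.
split=> [|n]; first by rewrite size_poly1.
rewrite -/(pmul 1 (binser _) n) pmul1 add0r /hyper_coef.
by rewrite -polyC1 hornerC mul1r.
Qed.

(** The Eulerian polynomial attached to [\prod_j (1 + b_j X)]. *)
Fixpoint eulerian_poly a (bs : seq R) : {poly R} :=
  if bs is b :: bs' then
    eulerian_step ((size bs')%:R + a) b (eulerian_poly a bs')
  else 1.

Lemma eulerian_polyP a bs :
  eulerian (size bs) a (\prod_(b <- bs) (1 + b *: 'X)) (eulerian_poly a bs).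
Proof.
elim: bs => [|b bs IH] /=; first by rewrite big_nil; exact: eulerian0.
by rewrite big_cons; exact: eulerian_stepP.
Qed.

End Eulerian.

(** * Interlacing of the real roots *)

Section Interlacing.
Variable R : rcfType.
Implicit Types (a s b x : R) (w N : {poly R}) (rs xs : seq R).

Lemma le_path_last x xs : path <%R x xs -> x <= last x xs.
Proof.
elim: xs x => //= y xs IH x /andP[xy py].
by rewrite (le_trans (ltW xy)) // IH.
Qed.

Lemma path_lt_uniq x xs : path <%R x xs -> uniq xs.
Proof. by move/path_sorted/(sorted_uniq lt_trans ltxx). Qed.

(** A polynomial whose signs alternate along an increasing sequence has a root
    strictly between any two consecutive points. *)
Lemma alternating_roots N x0 xs : path <%R x0 xs ->
    (forall i, (i <= size xs)%N -> 0 < (-1) ^+ i * N.[nth 0 (x0 :: xs) i]) ->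
  exists ys, [/\ size ys = size xs, path <%R x0 ys,
    all (fun y => y < last x0 xs) ys & all (root N) ys].
Proof.
elim: xs x0 N => [|x1 xs IH] x0 N /=; first by exists [::].
move=> /andP[x01 px] sgn.
have s0 := sgn 0%N isT; have s1 := sgn 1%N isT.
rewrite /= expr0 mul1r in s0; rewrite /= expr1 mulN1r oppr_gt0 in s1.
have [i i_le|ys [sz py lty rty]] := IH x1 (- N) px.
  by have := sgn i.+1 i_le; rewrite /= exprS hornerN mulN1r mulNr mulrN.
have sgn01 : N.[x0] * N.[x1] < 0 by rewrite pmulr_rlt0.
have [y] := poly_ivtoo (ltW x01) sgn01.
rewrite in_itv /= => /andP[xy yx] ry; exists (y :: ys); split => /=.
- by rewrite sz.
- by rewrite xy /= (path_le lt_trans yx).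
- by rewrite lty andbT (lt_le_trans yx) // le_path_last.
- by rewrite ry /=; apply: sub_all rty => z; rewrite rootN.
Qed.

(** Each root to the right of [x] contributes a negative factor. *)
Lemma prod_XsubC_sgn (l1 l2 : seq R) x :
    all (fun y => y < x) l1 -> all (fun y => x < y) l2 ->
  0 < (-1) ^+ size l2 * (\prod_(y <- l1 ++ l2) ('X - y%:P)).[x].
Proof.
move=> h1 h2; rewrite big_cat hornerM mulrCA; apply: mulr_gt0.
  rewrite horner_prod; elim: l1 h1 => [|y l IH] /=; first by rewrite big_nil.
  by case/andP=> yx hl; rewrite big_cons mulr_gt0 ?IH // hornerXsubC subr_gt0.
rewrite horner_prod; elim: l2 h2 => [|y l IH] /=.
  by rewrite big_nil mulr1.
case/andP=> yx hl; rewrite big_cons exprS hornerXsubC mulrACA mulr_gt0 ?IH //.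
by rewrite mulN1r opprB subr_gt0.
Qed.

Lemma coef_eulerian_step_top s b w k : (size w <= k.+1)%N ->
  (eulerian_step s b w)`_k.+1 = (b * (s - k%:R) - 1) * w`_k.
Proof.
move=> szw; have wk : w`_k.+1 = 0 by rewrite nth_default.
have dwk : ('X * w^`())`_k = k%:R * w`_k.
  by rewrite coefXM coef_deriv mulr_natl; case: k {szw wk}.
rewrite /eulerian_step coefD coefZ coefXM /= coefD coefZ.
rewrite !mulrBl !mul1r !coefB dwk coefXM coef_deriv wk mul0rn /=.
by ring.
Qed.

(** The situation propagated by induction: [w] has all its roots, which are
    simple, in the interval [(0, 1)], and [w(0) = 1]. *)
Definition real_simple_01 w (rs : seq R) : Prop :=
  [/\ path <%R 0 rs, all (fun r => r < 1) rs,
      w = lead_coef w *: \prod_(r <- rs) ('X - r%:P) & w.[0] = 1].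

Section Step.
Variables (w : {poly R}) (rs : seq R) (s b : R).
Hypotheses (b_gt0 : 0 < b) (hw : real_simple_01 w rs).

Let rs_gt0 : all (fun r => 0 < r) rs.
Proof. by case: hw => + _ _ _; exact: (order_path_min lt_trans). Qed.

Lemma sgn_lead_coef : 0 < (-1) ^+ size rs * lead_coef w.
Proof.
case: hw => _ _ wE w0.
have := prod_XsubC_sgn (l1 := [::]) (x := 0) isT rs_gt0.
set P := _.[0] => hP; have : lead_coef w * P = 1 by rewrite -w0 {2}wE hornerZ.
by move=> h; rewrite -(pmulr_lgt0 _ hP) mulrACA h mulr1 -expr2 sqrr_sign.
Qed.

Lemma sgn_at1 : 0 < (-1) ^+ size rs * w.[1].
Proof.
case: hw => _ rs1 wE _; rewrite wE hornerZ mulrA mulr_gt0 ?sgn_lead_coef //.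
have := prod_XsubC_sgn (l2 := [::]) rs1 isT.
by rewrite mul1r cats0.
Qed.

Lemma eulerian_step0 : (eulerian_step s b w).[0] = 1.
Proof.
case: hw => _ _ _ w0.
by rewrite /eulerian_step hornerD hornerZ !hornerM hornerX hornerD hornerN
  hornerX hornerC w0; ring.
Qed.

Lemma eulerian_step1 : (eulerian_step s b w).[1] = b * s * w.[1].
Proof.
rewrite /eulerian_step !(hornerD, hornerZ, hornerM, hornerX, hornerN, hornerC).
by ring.
Qed.

Lemma sgn_eulerian_step i : (i <= size rs)%N ->
  0 < (-1) ^+ i * (eulerian_step s b w).[nth 0 (0 :: rs) i].
Proof.
case: i => [|i] i_lt; first by rewrite expr0 mul1r eulerian_step0.
case: (hw) => srt rs1 wE _ /=.
set r := nth 0 rs i.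
have r_in : r \in rs by exact: mem_nth.
have r0 : 0 < r by exact: (allP rs_gt0).
have r1 : r < 1 by exact: (allP rs1).
have rsE : rs = take i rs ++ r :: drop i.+1 rs by rewrite -drop_nth //
  cat_take_drop.
have srt' : pairwise <%R rs.
  by move: srt; rewrite (path_pairwise lt_trans) => /andP[].
move: srt'; rewrite {1}rsE pairwise_cat /= allrel_consr => /and4P[/andP[lt1 _]
  _ lt2 _].
have wr : w.[r] = 0.
  by rewrite wE hornerZ; apply/eqP; rewrite mulf_eq0 -/(root _ r)
    root_prod_XsubC r_in orbT.
have w'r : w^`().[r] = lead_coef w * (\prod_(y <- take i rs ++ drop i.+1 rs)
  ('X - y%:P)).[r].
  rewrite {1}wE derivZ hornerZ; congr (_ * _).
  rewrite {1}rsE big_cat big_cons /= mulrCA derivM -big_cat.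
  by rewrite derivXsubC mul1r hornerD hornerM hornerXsubC subrr mul0r addr0.
have NE : (eulerian_step s b w).[r] = b * r * (1 - r) * w^`().[r].
  rewrite /eulerian_step !(hornerD, hornerZ, hornerM, hornerX, hornerN,
    hornerC) wr.
  by ring.
have sgn1 := prod_XsubC_sgn lt1 lt2.
have szE : size rs = (i.+1 + size (drop i.+1 rs))%N by rewrite size_drop subnKC.
have sgn2 := sgn_lead_coef; rewrite szE exprD in sgn2.
have : 0 < (-1) ^+ i.+1 * w^`().[r].
  rewrite w'r; set k := size _ in sgn1 sgn2; set P := _.[r] in sgn1 *.
  have -> : (-1) ^+ i.+1 * (lead_coef w * P) =
     ((-1) ^+ i.+1 * (-1) ^+ k * lead_coef w) * ((-1) ^+ k * P).
    move: (sqrr_sign R k) ((-1) ^+ i.+1); move: ((-1) ^+ k) => u u2 v.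
    by rewrite -[LHS]mul1r -u2; ring.
  exact: mulr_gt0.
rewrite NE => h; rewrite mulrCA; apply: mulr_gt0 => //.
by rewrite !mulr_gt0 // subr_gt0.
Qed.

End Step.

(** Between [0], the roots of [w] and, for [s < 0], the point [1], the step
    polynomial alternates in sign, so that it gains one root in [(0, 1)]. *)
Lemma real_simple_01_step w rs s b : 0 < b -> s < 0 ->
    (size (eulerian_step s b w) <= (size rs).+2)%N ->
    real_simple_01 w rs ->
  exists2 rs', size rs' = (size rs).+1 &
    real_simple_01 (eulerian_step s b w) rs'.
Proof.
move=> b0 s0 szN hw; case: (hw) => srt rs1 _ _; set N := eulerian_step s b w.
have N0 : N.[0] = 1 := eulerian_step0 s b hw.
have [|i|ys [sz py lty rty]] := @alternating_roots N 0 (rcons rs 1).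
- by rewrite rcons_path srt; case/lastP: rs rs1 {srt szN hw} => //= rs r;
    rewrite last_rcons all_rcons => /andP[].
- rewrite size_rcons leq_eqVlt => /predU1P[->|]; last first.
    rewrite ltnS => i_le; have := sgn_eulerian_step s b0 hw i_le.
    by rewrite -rcons_cons nth_rcons /= ltnS i_le.
  rewrite -rcons_cons nth_rcons /= ltnn eqxx eulerian_step1 exprS.
  by rewrite mulrACA mulr_gt0 ?sgn_at1 // mulN1r oppr_gt0 pmulr_rlt0.
rewrite size_rcons last_rcons in sz lty; exists ys => //; split => //.
have ysu := path_lt_uniq py.
have Nn0 : N != 0.
  by apply: contra_eq_neq N0 => ->; rewrite horner0 eq_sym oner_eq0.
apply: all_roots_prod_XsubC => //; last by rewrite uniq_rootsE.
by apply/eqP; rewrite eqn_leq sz szN -sz max_poly_roots.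
Qed.

(** For [s >= 0] the alternation stops at the last root of [w]. The leading
    coefficient of the step polynomial is [b (s - size rs) - 1 < 0] times that
    of [w]; its sign and the sign at [1] put the remaining root in
    [[1, +oo)]. *)
Lemma real_simple_01_last_step w rs s b : 0 < b -> 0 <= s ->
    b * (s - (size rs)%:R) < 1 ->
    (size (eulerian_step s b w) <= (size rs).+2)%N ->
    real_simple_01 w rs ->
  exists x0 rs', [/\ 1 <= x0, all (fun r => 0 < r < 1) rs',
    eulerian_step s b w != 0 &
    eulerian_step s b w = lead_coef (eulerian_step s b w) *:
      \prod_(r <- x0 :: rs') ('X - r%:P)].
Proof.
move=> b0 s0 hs szN hw; case: (hw) => srt rs1 wE _.
set N := eulerian_step s b w in szN *; set k := size rs in hs szN.
have N0 : N.[0] = 1 := eulerian_step0 s b hw.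
have Nn0 : N != 0.
  by apply: contra_eq_neq N0 => ->; rewrite horner0 eq_sym oner_eq0.
have [|ys [szy py lty rty]] := @alternating_roots N 0 rs srt.
  exact: sgn_eulerian_step.
have ys01 : all (fun r => 0 < r < 1) ys.
  apply/allP => y yin; rewrite (allP (order_path_min lt_trans py)) //=.
  rewrite (lt_le_trans (allP lty _ yin)) //.
  case/lastP: (rs) rs1 => [|l r] //=.
  by rewrite last_rcons all_rcons => /andP[/ltW].
pose P : {poly R} := \prod_(y <- ys) ('X - y%:P).
have [q NE] : exists q : {poly R}, N = q * P.
  apply: uniq_roots_prod_XsubC rty _.
  by rewrite uniq_rootsE (path_lt_uniq py).
have Pmon : P \is monic by exact: monic_prod_XsubC.
have szP : size P = k.+1 by rewrite size_prod_XsubC szy.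
have q_neq0 : q != 0 by apply: contraNneq Nn0 => q0; rewrite NE q0 mul0r.
have szq : (size q <= 2)%N.
  by move: szN; rewrite NE size_Mmonic // szP addnS /= -(add2n k) leq_add2r.
have qE : q = q`_1 *: 'X + (q`_0)%:P.
  apply/polyP => -[|[|i]]; rewrite coefD coefZ coefX coefC ?mulr0 ?mulr1 ?add0r
    ?addr0 //.
  by rewrite nth_default // (leq_trans szq).
have szw : size w = k.+1.
  rewrite wE size_scale ?size_prod_XsubC // lead_coef_eq0.
  apply/eqP => w0; have := sgn_lead_coef hw.
  by rewrite w0 lead_coef0 mulr0 ltxx.
have lcN : q`_1 = (b * (s - k%:R) - 1) * lead_coef w.
  have -> : q`_1 = N`_k.+1.
    rewrite NE {2}qE mulrDl coefD -scalerAl coefZ coefXM /= mul_polyC coefZ.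
    have := monicP Pmon; rewrite lead_coefE szP /= => ->.
    by rewrite (nth_default _ (_ : size P <= k.+1)%N) ?szP // mulr0 addr0 mulr1.
  by rewrite /N coef_eulerian_step_top ?szw // lead_coefE szw.
have sq1 : (-1) ^+ k * q`_1 < 0.
  by rewrite lcN mulrCA nmulr_rlt0 ?subr_lt0 //; exact: sgn_lead_coef.
have sq : 0 <= (-1) ^+ k * (q`_0 + q`_1).
  have P1 : 0 < P.[1].
    have lt1 : all (fun y => y < 1) ys by apply: sub_all ys01 => y /andP[].
    by have := prod_XsubC_sgn (l2 := [::]) lt1 isT; rewrite mul1r cats0.
  rewrite -(pmulr_lge0 _ P1) -mulrA.
  have -> : (q`_0 + q`_1) * P.[1] = b * s * w.[1].
    rewrite -eulerian_step1 -/N NE hornerM {3}qE.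
    by rewrite hornerD hornerZ hornerX hornerC mulr1 addrC.
  rewrite mulrCA; apply: mulr_ge0; first exact: mulr_ge0 (ltW b0) s0.
  exact: ltW (sgn_at1 hw).
have q1n0 : q`_1 != 0 by apply: contraTneq sq1 => ->; rewrite mulr0 ltxx.
exists (- q`_0 / q`_1), ys; split => //.
  have sgn_n0 : (-1) ^+ k != 0 :> R by rewrite signr_eq0.
  have -> : - q`_0 / q`_1 = ((-1) ^+ k * q`_0) / (- ((-1) ^+ k * q`_1)).
    by move: ((-1) ^+ k) sgn_n0 => u u0; field; rewrite q1n0 u0.
  rewrite ler_pdivlMr ?oppr_gt0 // mul1r -subr_ge0 opprK -mulrDr //.
have NE' : N = q`_1 *: \prod_(r <- (- q`_0 / q`_1) :: ys) ('X - r%:P).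
  rewrite big_cons NE {1}qE -/P scalerAl; congr (_ * _).
  by rewrite scalerBr -mul_polyC -[_ *: _%:P]mul_polyC -polyCM mulNr mulrN
    mulrCA divff // mulr1 polyCN opprK.
rewrite {1}NE'; congr (_ *: _).
by rewrite NE' lead_coefZ (monicP (monic_prod_XsubC _ _ _)) mulr1.
Qed.

Lemma eulerian_poly_roots a (bs : seq R) :
    all (fun b => 0 < b) bs -> a + (size bs)%:R < 1 ->
  exists2 rs, size rs = size bs & real_simple_01 (eulerian_poly a bs) rs.
Proof.
elim: bs => [|b bs IH] /=.
  move=> _ _; exists [::] => //; split => //=; last by rewrite hornerC.
  by rewrite big_nil lead_coef1 scale1r.
case/andP=> b0 bs0; rewrite -natr1 => ha.
have [|rs szrs hrs] := IH bs0; first by lra.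
have [] := real_simple_01_step b0 (_ : (size bs)%:R + a < 0) _ hrs; first by
  lra.
  by rewrite szrs; have [] := eulerian_polyP a (b :: bs).
by move=> rs' szrs' hrs'; exists rs' => //; rewrite szrs' szrs.
Qed.

End Interlacing.

(** * Convergent power series *)

Section PowerSeries.
Variable K : numFieldType.
Local Notation C := (K^o).
Implicit Types (f g : C -> C) (z h u v : C) (c : nat -> C).

(** [f] is near [z] the sum of the power series [c] centered at [z]; over the
    complex numbers, this is [has_expansion]. *)
Definition expands f z c : Prop :=
  \forall x \near z, series (fun n => c n * (x - z) ^+ n) @ \oo --> f x.

(** A disc of convergence, with Cauchy bounds for the coefficients: the terms at
    a point where the series converges are bounded. *)
Lemma expands_radius f z c : expands f z c ->
  exists d M : K, [/\ 0 < d, 0 < M, forall n, `|c n| * d ^+ n <= M &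
    forall x, `|x - z| < d ->
      series (fun n => c n * (x - z) ^+ n) @ \oo --> f x].
Proof.
case/nbhs_ballP => e /= e0 he.
have he' x : `|x - z| < e -> series (fun n => c n * (x - z) ^+ n) @ \oo --> f x.
  by move=> xz; apply: he; rewrite -ball_normE /= distrC.
have d0 : 0 < e / 2 by rewrite divr_gt0.
have de : e / 2 < e by rewrite ltr_pdivrMr // mulr_natr mulr2n ltrDl.
have [|M M0 hM] := pinfty_ex_gt0 (cvg_seq_bounded (a := fun n => c n * (e / 2 :
  C) ^+ n) _).
  apply: cvgP; apply: cvg_series_cvg_0; apply: cvgP.
  have := he' (z + (e / 2 : C)); rewrite addrC addKr; apply.
  by rewrite gtr0_norm.
exists (e / 2), M; split => //.
  by move=> n; have := hM n I; rewrite /= normrM normrX (gtr0_norm d0).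
by move=> x xd; apply: he'; exact: lt_trans de.
Qed.

Lemma series_at0 c : series (fun n => c n * (0 : C) ^+ n) @ \oo --> c 0%N.
Proof.
rewrite -cvg_shiftS; apply: cvg_near_cst; near=> n.
rewrite /series /= big_nat_recl //= expr0 mulr1 big1 ?addr0 // => i _.
by rewrite expr0n mulr0.
Unshelve. all: by end_near.
Qed.

(** Second-order Taylor bound for a monomial. *)
Lemma normr_taylor2 (u v t : K) n : `|u| <= t -> `|u + v| <= t ->
  `|(u + v) ^+ n - u ^+ n - n%:R * u ^+ n.-1 * v| * t ^+ 2
    <= 'C(n, 2)%:R * t ^+ n * `|v| ^+ 2.
Proof.
move=> ut uvt; have t0 : 0 <= t by apply: le_trans ut.
elim: n => [|n IH].
  by rewrite bin0n /= !mulr0n expr0 subrr !mul0r subrr normr0 mul0r.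
have -> : (u + v) ^+ n.+1 - u ^+ n.+1 - n.+1%:R * u ^+ n.+1.-1 * v =
   (u + v) * ((u + v) ^+ n - u ^+ n - n%:R * u ^+ n.-1 * v)
   + n%:R * u ^+ n.-1 * v ^+ 2.
  rewrite /= -natr1; case: n {IH} => [|n] /=.
    by rewrite !expr0 expr1; ring.
  by rewrite !exprS; ring.
rewrite binS bin1 natrD -[leRHS]mulrA [leRHS]mulrDl.
apply: (le_trans (ler_wpM2r (exprn_ge0 2 t0) (ler_normD _ _))).
rewrite mulrDl lerD //.
  have -> : 'C(n, 2)%:R * (t ^+ n.+1 * `|v| ^+ 2) =
      t * ('C(n, 2)%:R * t ^+ n * `|v| ^+ 2) by rewrite exprS; ring.
  by rewrite normrM -mulrA ler_pM // mulr_ge0 // exprn_ge0.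
case: n {IH} => [|n] /=; first by rewrite !mulr0n !mul0r normr0 mul0r.
have -> : n.+1%:R * (t ^+ n.+2 * `|v| ^+ 2) =
    n.+1%:R * `|v| ^+ 2 * t ^+ 2 * t ^+ n by rewrite !exprS; ring.
have -> : `|n.+1%:R * u ^+ n * v ^+ 2| * t ^+ 2 =
    n.+1%:R * `|v| ^+ 2 * t ^+ 2 * `|u| ^+ n.
  by rewrite !normrM normr_nat !normrX; ring.
by rewrite ler_wpM2l ?mulr_ge0 ?exprn_ge0 // lerXn2r ?nnegrE.
Qed.

Lemma bin2_le_exp2 n : ('C(n, 2) <= 2 ^ n)%N.
Proof.
elim: n => // n IH; rewrite binS bin1 expnS mul2n -addnn leq_add // ltnW //.
exact: ltn_expl.
Qed.

Lemma geometric_half_sum N : \sum_(0 <= n < N) (2^-1 : K) ^+ n <= 2.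
Proof.
suff -> : \sum_(0 <= n < N) (2^-1 : K) ^+ n = 2 - 2 * 2^-1 ^+ N.
  by rewrite gerBl mulr_ge0 // exprn_ge0 // invr_ge0.
elim: N => [|N IH]; first by rewrite big_nil; ring.
by rewrite big_nat_recr //= IH exprS; field.
Qed.

(** The same bound for the partial sums of a power series, uniform in the
    number of terms. With [u] and [u + v] in the disc of radius [d / 4], the
    [n]-th term has a factor [C(n, 2) / 4 ^ n <= 1 / 2 ^ n]. *)
Lemma psum_taylor2 c (d M : K) u v N : 0 < d ->
    (forall n, `|c n| * d ^+ n <= M) ->
    `|u| <= d / 4 -> `|u + v| <= d / 4 ->
  `|\sum_(0 <= n < N) c n * (u + v) ^+ n - \sum_(0 <= n < N) c n * u ^+ n
    - (\sum_(0 <= n < N) c n * (n%:R * u ^+ n.-1)) * v|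
  <= 32 * M / d ^+ 2 * `|v| ^+ 2.
Proof.
move=> d0 hc hu huv.
have t0 : 0 < d / 4 by rewrite divr_gt0.
rewrite mulr_suml -!sumrB.
apply: (le_trans (ler_norm_sum _ _ _)).
apply: (@le_trans _ _ (\sum_(0 <= n < N) (16 * M / d ^+ 2 * `|v| ^+ 2) * 2^-1
  ^+ n)); last first.
  rewrite -mulr_sumr; have -> : 32 * M / d ^+ 2 * `|v| ^+ 2 = 16 * M / d ^+ 2 *
    `|v| ^+ 2 * 2.
    ring.
  apply: ler_wpM2l; last exact: geometric_half_sum.
  have M0 : 0 <= M by apply: le_trans (hc 0%N); rewrite mulr_ge0 // exprn_ge0
    ?ltW.
  by rewrite !mulr_ge0 // invr_ge0 exprn_ge0 // ltW.
apply: ler_sum => n _.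
have -> : c n * (u + v) ^+ n - c n * u ^+ n - c n * (n%:R * u ^+ n.-1) * v =
  c n * ((u + v) ^+ n - u ^+ n - n%:R * u ^+ n.-1 * v) by ring.
rewrite normrM.
have := normr_taylor2 n hu huv.
set T := `|_ - _ - _| => hT.
have {}hT : T <= 'C(n, 2)%:R * (d / 4) ^+ n * `|v| ^+ 2 / (d / 4) ^+ 2.
  by rewrite ler_pdivlMr // exprn_gt0.
apply: (le_trans (ler_wpM2l (normr_ge0 _) hT)).
have dn0 m : d ^+ m != 0 by rewrite expf_neq0 // gt_eqF.
have -> : `|c n| * ('C(n, 2)%:R * (d / 4) ^+ n * `|v| ^+ 2 / (d / 4) ^+ 2) =
   (`|c n| * d ^+ n) * ('C(n, 2)%:R / 2 ^+ n) * (16 / d ^+ 2 * `|v| ^+ 2 * 2^-1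
     ^+ n).
  have -> : (d / 4) ^+ n = d ^+ n * (2^-1 ^+ n * 2^-1 ^+ n).
    rewrite -!exprMn; congr (_ ^+ n); by field.
  rewrite !exprVn; have x0 : 2 ^+ n != 0 :> K by rewrite expf_neq0.
  move: (2 ^+ n) (d ^+ n) x0 => x y x0.
  by field; rewrite x0 gt_eqF.
have -> : 16 * M / d ^+ 2 * `|v| ^+ 2 * 2^-1 ^+ n =
   M * 1 * (16 / d ^+ 2 * `|v| ^+ 2 * 2^-1 ^+ n) by ring.
rewrite ler_wpM2r //.
  have d2 : 0 <= d ^+ 2 by rewrite exprn_ge0 // ltW.
  have half0 : 0 <= 2^-1 ^+ n :> K by rewrite exprn_ge0 // invr_ge0.
  apply: mulr_ge0 half0; apply: mulr_ge0 (exprn_ge0 2 (normr_ge0 v)).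
  exact: divr_ge0.
have cd0 : 0 <= `|c n| * d ^+ n by rewrite mulr_ge0 // exprn_ge0 // ltW.
have b0 : 0 <= 'C(n, 2)%:R / 2 ^+ n :> K by rewrite divr_ge0 // exprn_ge0.
apply: ler_pM cd0 b0 (hc n) _.
by rewrite ler_pdivrMr ?exprn_gt0 // mul1r -natrX ler_nat bin2_le_exp2.
Qed.

End PowerSeries.

(** * Zeros of analytic functions *)

Section Expansions.
Variable K : numFieldType.
Local Notation C := (K^o).
Implicit Types (f g : C -> C) (z h u v : C) (c : nat -> C).

Lemma pos_lower_bound2 (x y : K) : 0 < x -> 0 < y ->
  exists e : K, [/\ 0 < e, e <= x & e <= y].
Proof.
move=> x0 y0; have xy0 : 0 < x + y by rewrite addr_gt0.
exists (x * y / (x + y)).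
split; first by rewrite divr_gt0 // mulr_gt0.
  by rewrite ler_pdivrMr // ler_pM2l // lerDr ltW.
by rewrite ler_pdivrMr // mulrC ler_pM2l // lerDl ltW.
Qed.

Lemma expands_taylor2 f z c : expands f z c ->
  exists r A : K, [/\ 0 < r, 0 < A & forall v, `|v| <= r ->
    `|f (z + v) - c 0%N - c 1%N * v| <= A * `|v| ^+ 2].
Proof.
case/expands_radius => d [M [d0 M0 hc cvf]].
have d4 : 0 < d / 4 by rewrite divr_gt0.
have d4d : d / 4 < d by rewrite ltr_pdivrMr // ltr_pMr // ltr1n.
have A0 : 0 < 32 * M / d ^+ 2 by rewrite divr_gt0 ?mulr_gt0 ?exprn_gt0.
exists (d / 4), (32 * M / d ^+ 2); split => // v hv.
apply/ler_addgt0Pr => e e0.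
have := cvf (z + v); rewrite addrC addKr => /(_ (le_lt_trans hv d4d)).
move/cvgrPdist_le => /(_ e e0) [N0 _ hN0].
pose N := N0.+2; have := hN0 N (leqW (leqW (leqnn N0))).
have := psum_taylor2 (u := 0) (v := v) N d0 hc.
rewrite normr0 add0r => /(_ (ltW d4) hv).
have -> : \sum_(0 <= n < N) c n * (0 : C) ^+ n = c 0%N.
  rewrite big_nat_recl //= expr0 mulr1 big1 ?addr0 // => i _.
  by rewrite expr0n mulr0.
have -> : \sum_(0 <= n < N) c n * (n%:R * (0 : C) ^+ n.-1) = c 1%N.
  rewrite 2?big_nat_recl //= mulr0n mul0r mulr0 add0r expr0 !mulr1 big1 ?addr0
    // => i _.
  by rewrite expr0n !mulr0.
set S := \sum_(0 <= n < N) _ => h1 h2.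
have -> : f (z + v) - c 0%N - c 1%N * v =
   (S - c 0%N - c 1%N * v) + (f (z + v) - S) by ring.
by apply: (le_trans (ler_normD _ _)); exact: lerD.
Qed.

Lemma expands_center f z c : expands f z c -> f z = c 0%N.
Proof.
case/expands_taylor2 => r [A [r0 _ /(_ 0)]].
rewrite normr0 addr0 mulr0 subr0 expr0n mulr0 => /(_ (ltW r0)).
by rewrite normr_le0 subr_eq0 => /eqP.
Qed.

(** A power series with nonzero constant term does not vanish near its
    center. *)
Lemma expands_neq0 f z c : expands f z c -> c 0%N != 0 ->
  \forall x \near z, f x != 0.
Proof.
move=> /expands_taylor2[r [A [r0 A0 hA]]] c0.
have B0 : 0 < `|c 1%N| + A * r + 1.
  by rewrite ltr_wpDl // addr_ge0 // mulr_ge0 // ltW.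
have cB0 : 0 < `|c 0%N| / (`|c 1%N| + A * r + 1) by rewrite divr_gt0 //
  normr_gt0.
have [e [e0 er ec]] := pos_lower_bound2 r0 cB0.
apply/nbhs_ballP; exists e => //= x; rewrite -ball_normE /= distrC => xe.
have := hA (x - z) (le_trans (ltW xe) er); rewrite (addrC z) subrK.
apply: contraTneq => ->; set v := x - z in xe *.
rewrite sub0r -opprD normrN.
apply/negP => h.
have : `|c 0%N| <= `|c 1%N| * `|v| + A * `|v| ^+ 2.
  have -> : c 0%N = (c 0%N + c 1%N * v) - c 1%N * v by ring.
  by apply: (le_trans (ler_normB _ _)); rewrite addrC normrM lerD2l.
apply/negP; rewrite -real_ltNge ?ger0_real //; last first.
  by rewrite addr_ge0 // mulr_ge0 // ?ltW // exprn_ge0.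
have {}ec : `|v| * (`|c 1%N| + A * r + 1) < `|c 0%N|.
  by rewrite -ltr_pdivlMr // (lt_le_trans xe).
apply: le_lt_trans ec.
have -> : `|c 1%N| * `|v| + A * `|v| ^+ 2 = `|v| * (`|c 1%N| + A * `|v|).
  by ring.
rewrite ler_wpM2l // -addrA lerD2l -[leLHS]addr0 lerD // ler_pM2l //.
by rewrite ltW // (lt_le_trans xe).
Qed.

Lemma cvg_psum_shift (a : nat -> C) (l : C) k : series a @ \oo --> l ->
    (forall j, (j < k)%N -> a j = 0) ->
  series (fun n => a (n + k)%N) @ \oo --> l.
Proof.
move=> al a0; rewrite -(cvg_shiftn k) in al.
apply: cvg_trans al; apply: near_eq_cvg; apply: nearW => n /=.
rewrite /series /= (@big_cat_nat _ _ _ k) ?leq_addl //=.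
rewrite big_nat_cond big1 ?add0r; last by move=> i /andP[/a0 ->].
by rewrite -{1}[k]add0n big_addn addnK.
Qed.

(** Division by [(x - z) ^ k]. The value at [z] itself has to be prescribed. *)
Lemma expands_shift f z c k :
    expands f z c -> (forall j, (j < k)%N -> c j = 0) ->
  expands (fun x => if x == z then c k else f x / (x - z) ^+ k) z
    (fun n => c (n + k)%N).
Proof.
move=> hf ck; rewrite /expands; near=> x.
have hx : series (fun n => c n * (x - z) ^+ n) @ \oo --> f x by near: x.
case: eqP => [->|/eqP xz]; first by rewrite subrr; exact: (@series_at0 K (fun n
  => c (n + k)%N)).
have xz0 : (x - z) ^+ k != 0 by rewrite expf_neq0 // subr_eq0.
have sk : series (fun n => c (n + k)%N * (x - z) ^+ (n + k)) @ \oo --> f x.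
  by apply: (cvg_psum_shift hx) => j /ck ->; rewrite mul0r.
refine (cvg_trans _ (cvgMr_tmp (b := (x - z) ^- k) sk)).
apply: near_eq_cvg; apply: nearW => n.
rewrite /series /= mulr_suml; apply: eq_bigr => i _.
by rewrite exprD mulrA mulfK.
Unshelve. all: by end_near.
Qed.

Lemma series_const0 c x l :  (forall n, c n = 0) ->
  series (fun n => c n * x ^+ n) @ \oo --> l -> l = 0.
Proof.
move=> c0 cl; apply: (cvg_unique _ cl) => //.
apply: cvg_near_cst; apply: nearW => n.
by rewrite /series /= big1 // => i _; rewrite c0 mul0r.
Qed.

(** Zeros are isolated unless all coefficients vanish. *)
Lemma expands_isolated f z c : expands f z c -> (exists n, c n != 0) ->
  \forall x \near z^', f x != 0.
Proof.
move=> hf /ex_minnP[k ck kmin].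
have ck0 j : (j < k)%N -> c j = 0.
  by move=> jk; apply/eqP; apply: contraTT jk => /kmin; rewrite -leqNgt.
have := expands_neq0 (expands_shift hf ck0) ck.
rewrite /dnbhs; apply: filterS => x + xz.
by rewrite (negPf xz); apply: contra => /eqP ->; rewrite mul0r.
Qed.

Lemma expands_dichotomy f z c : expands f z c ->
  (\forall x \near z, f x = 0) \/ (\forall x \near z^', f x != 0).
Proof.
move=> hf; have [[n cn]|c0] := pselect (exists n, c n != 0).
  by right; apply: expands_isolated hf _; exists n.
left; apply: filterS hf => x; apply: series_const0 => n.
by apply/eqP/negPn/negP => cn; apply: c0; exists n.
Qed.

Lemma expands_eq0 f z c : expands f z c -> (\forall x \near z, f x = 0) ->
  forall n, c n = 0.
Proof.
move=> hf f0 n; apply/eqP/negPn/negP => cn.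
have fn0 := expands_isolated hf (ex_intro _ n cn).
have : \forall x \near z^', False.
  near=> x; have /eqP : f x != 0 by near: x.
  by apply; near: x; exact: nbhs_dnbhs.
by move/filter_ex => [].
Unshelve. all: by end_near.
Qed.

(** The points near which [f] vanishes form an open set, which is also closed in
    [D] because zeros are isolated. *)
Lemma identity_theorem (D : set C) f z0 : connected D ->
    (forall z, D z -> exists c, expands f z c) ->
    D z0 -> (\forall x \near z0, f x = 0) ->
  forall z, D z -> \forall x \near z, f x = 0.
Proof.
move=> cD af Dz0 fz0.
pose Z : set C := [set z : C | \forall x \near z, f x = 0].
suff DZ : D `&` Z = D by move=> z; rewrite -{1}DZ => -[].
have oZ : open Z by rewrite openE => z /near_join; apply: filterS.
apply: cD.
- by exists z0.
- by exists Z.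
exists (closure (D `&` Z)); first exact: closed_closure.
rewrite eqEsubset; split => [z [Dz Zz]|z [Dz clz]].
  by split=> //; exact: subset_closure.
split=> //; have [c /expands_dichotomy[//|fn0]] := af z Dz.
rewrite /dnbhs /within /= in fn0.
have [y [[Dy Zy] fy]] := clz _ fn0.
have [<- //|yz] := eqVneq y z.
by have := fy yz; rewrite (nbhs_singleton Zy) eqxx.
Qed.

End Expansions.

(** * Derivatives and products of expansions *)

Section Derivative.
Variable K : numFieldType.
Local Notation C := (K^o).
Implicit Types (f g : C -> C) (z h u v : C) (c : nat -> C).

(** Termwise differentiation, phrased without derivatives: the linear
    coefficient of any expansion at a nearby point [x] is the sum at [x] of the
    derived series. The limit need not be known to exist beforehand, so that
    completeness plays no role. *)
Lemma expands_deriv f z c : expands f z c ->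
  \forall x \near z, forall c', expands f x c' ->
    series (fun n => dser c n * (x - z) ^+ n) @ \oo --> c' 1%N.
Proof.
case/expands_radius => d [M [d0 M0 hc cvf]].
have d8 : 0 < d / 8 by rewrite divr_gt0.
apply/nbhs_ballP; exists (d / 8) => //= x; rewrite -ball_normE /= distrC => xz.
move=> c' hc'; set u := x - z in xz *.
have [r [A [r0 A0 hA]]] := expands_taylor2 hc'.
have B0 : 0 < 32 * M / d ^+ 2 by rewrite divr_gt0 ?mulr_gt0 ?exprn_gt0.
set B := 32 * M / d ^+ 2 in B0 *.
have fx : f x = c' 0%N := expands_center hc'.
apply/cvgrPdist_le => e e0.
have AB0 : 0 < e / 2 / (A + B) by rewrite !divr_gt0 // addr_gt0.
(* The Taylor bounds of [f] at [x] and of the partial sums at [z] compare the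
   increments over a step [v] up to [(A + B) v ^ 2], which is at most half of
   [e * v]; the partial sums at [x] and [x + v] take up the other half. *)
have [v1 [v10 v1r v1d]] := pos_lower_bound2 r0 d8.
have [v [v0 vv1 vAB]] := pos_lower_bound2 v10 AB0.
have vn : `|v| = v by rewrite gtr0_norm.
have vr : `|v| <= r by rewrite vn (le_trans vv1).
have vd : v <= d / 8 by rewrite (le_trans vv1).
have d84 : d / 8 + d / 8 = d / 4 by field.
have hu : `|u| <= d / 4 by rewrite -d84 ltW // (lt_le_trans xz) // lerDl ltW.
have huv : `|u + v| <= d / 4.
  by rewrite -d84 (le_trans (ler_normD _ _)) // lerD // ?vn // ltW.
have d4d : d / 4 < d by rewrite ltr_pdivrMr // ltr_pMr // ltr1n.
have ev0 : 0 < e * v / 4 by rewrite divr_gt0 // mulr_gt0.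
have cv1 := cvf x (le_lt_trans hu d4d).
have xvz : x + v - z = u + v by rewrite /u addrAC.
have := cvf (x + v); rewrite xvz => /(_ (le_lt_trans huv d4d)) cv2.
move/cvgrPdist_le : cv1 => /(_ _ ev0) [N1 _ hN1].
move/cvgrPdist_le : cv2 => /(_ _ ev0) [N2 _ hN2].
exists (maxn N1 N2) => // N; rewrite /= geq_max => /andP[NN1 NN2].
have := hN1 N.+1 (leqW NN1); have := hN2 N.+1 (leqW NN2).
have := psum_taylor2 N.+1 d0 hc hu huv.
rewrite -/u /series /= -/B.
set S2 := \sum_(0 <= n < N.+1) _; set S1 := \sum_(0 <= n < N.+1) _.
set T := \sum_(0 <= n < N.+1) _.
have -> : \sum_(0 <= n < N) dser c n * u ^+ n = T.
  rewrite /T big_nat_recl //= mulr0n mul0r mulr0 add0r; apply: eq_bigr => i _.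
  by rewrite /dser mulrA (mulrC (c _)).
move=> h1 h2 h3; have h4 := hA v vr.
rewrite -(ler_pM2r v0) -{1}vn -normrM.
have -> : (c' 1%N - T) * v =
    (S2 - S1 - T * v) - (f (x + v) - c' 0%N - c' 1%N * v)
    + (f (x + v) - S2) - (f x - S1) by rewrite fx; ring.
have -> : e * v = e / 2 * v + e * v / 4 + e * v / 4 by field.
apply: (le_trans (ler_normB _ _)); rewrite lerD //.
apply: (le_trans (ler_normD _ _)); rewrite lerD //.
apply: (le_trans (ler_normB _ _)).
apply: (le_trans (lerD h1 h4)).
rewrite vn -mulrDl addrC expr2 mulrA ler_pM2r // mulrC.
by rewrite -ler_pdivlMr // addr_gt0.
Qed.

Lemma cvg_psumD (a b : nat -> C) (k l : C) :
    series a @ \oo --> k -> series b @ \oo --> l ->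
  series (a \+ b) @ \oo --> k + l.
Proof.
move=> ak bl; refine (cvg_trans _ (cvgD ak bl)).
apply: near_eq_cvg; apply: nearW => n.
by rewrite /series /= big_split.
Qed.

Lemma cvg_psumZ (a : nat -> C) (k l : C) :
  series a @ \oo --> l -> series (fun n => k * a n) @ \oo --> k * l.
Proof.
move=> al; refine (cvg_trans _ (cvgMl_tmp (a := k) al)).
apply: near_eq_cvg; apply: nearW => n.
by rewrite /series /= mulr_sumr.
Qed.

Lemma eq_psum (a b : nat -> C) (l : C) :
  a =1 b -> series a @ \oo --> l -> series b @ \oo --> l.
Proof. by move=> /funext ->. Qed.

Lemma cvg_pmul (p : {poly K}) c h (l : C) :
    series (fun n => c n * h ^+ n) @ \oo --> l ->
  series (fun n => pmul p c n * h ^+ n) @ \oo --> p.[h] * l.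
Proof.
move=> cl; elim/poly_ind: p => [|p a IH].
  rewrite horner0 mul0r; apply: cvg_near_cst; apply: nearW => n.
  rewrite /series /= big1 // => i _; rewrite (@pmulE _ i.+1) // mul0r coef0.
  by rewrite mul0r.
rewrite hornerMXaddC mulrDl.
apply: (@eq_psum ((fun n => pmul 'X (pmul p c) n * h ^+ n) \+ (fun n => a * (c
  n * h ^+ n)))).
  move=> n /=; rewrite pmulDl -[p * 'X]mulrC pmulA mulrDl; congr (_ + _).
  by rewrite -[a%:P]mulr1 mul_polyC pmulZl pmul1 mulrA.
apply: cvg_psumD; last exact: cvg_psumZ.
rewrite -cvg_shiftS mulrAC mulrC.
refine (cvg_trans _ (cvgMl_tmp (a := h) IH)).
apply: near_eq_cvg; apply: nearW => n.
rewrite /series /= big_nat_recl //= pmulX0 mul0r add0r mulr_sumr.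
by apply: eq_bigr => i _; rewrite pmulXS exprS mulrCA.
Qed.

End Derivative.

(** * The differential equation of the continuation *)

Section Equation.
Variable K : numFieldType.
Local Notation C := (K^o).
Implicit Types (p w : {poly K}) (c : nat -> K).

Lemma mulX_deriv_Xn k p :
  'X * ('X^k * p)^`() = 'X^k * (k%:R *: p + 'X * p^`()).
Proof.
rewrite derivM derivXn -mul_polyC polyC_natr -[_ *+ k]mulr_natl.
by case: k => [|k] /=; rewrite ?expr0 ?exprS; ring.
Qed.

Lemma trunc_Xn c j N : (forall i, (i < j)%N -> c i = 0) ->
  trunc (N + j) c = 'X^j * trunc N (fun i => c (i + j)%N).
Proof.
move=> c0; apply/polyP => n; rewrite coefXnM !coef_poly.
have [nj|jn] := ltnP n j; first by rewrite c0 // if_same.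
by rewrite ltn_subLR // addnC subnK.
Qed.

(** The indicial computation at [0], where the factor [u - X] does not vanish: a
    nonzero solution has the same order [k] as [W]. *)
Lemma ode_order (u s : K) (W1 : {poly K}) (k : nat) c :
    let W := 'X^k * W1 in
    u != 0 -> W1.[0] != 0 ->
    (forall n, pmul ((u%:P - 'X) * W) (dser c) n
             = pmul ((u%:P - 'X) * W^`() + s *: W) c n) ->
    (exists n, c n != 0) ->
  (forall j, (j < k)%N -> c j = 0) /\ c k != 0.
Proof.
move=> W u0 W10 hc /ex_minnP[j cj jmin].
have c0 i : (i < j)%N -> c i = 0.
  by move=> ij; apply/eqP; apply: contraTT ij => /jmin; rewrite -leqNgt.
suff -> : k = j by [].
pose T1 := trunc k.+2 (fun i => c (i + j)%N).
pose T := trunc (k.+2 + j) c.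
have TE : T = 'X^j * T1 by exact: trunc_Xn.
pose G := (u%:P - 'X) * W1 * (j%:R *: T1 + 'X * T1^`())
  - ((u%:P - 'X) * (k%:R *: W1 + 'X * W1^`()) + s *: 'X * W1) * T1.
pose E := (u%:P - 'X) * W * T^`() - ((u%:P - 'X) * W^`() + s *: W) * T.
(* Multiplied by [X], the equation no longer involves the exponent [k - 1]. *)
have EG : 'X * E = 'X^(k + j) * G.
  have -> : 'X * E = (u%:P - 'X) * W * ('X * T^`())
     - ((u%:P - 'X) * ('X * W^`()) + s *: 'X * W) * T.
    by rewrite /E -!mul_polyC; ring.
  by rewrite TE /W !mulX_deriv_Xn /G exprD -!mul_polyC; ring.
have E0 n : (n < k + j)%N -> E`_n = 0.
  move=> nk; rewrite /E coefB; apply/eqP; rewrite subr_eq0; apply/eqP.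
  have nN : (n.+1 < k.+2 + j)%N by rewrite !addSn !ltnS ltnW.
  rewrite -[RHS]pmulE ?(ltnW nN) // -hc (@pmulE _ n.+1) //.
  apply: coef_mul_agree => i ni; rewrite coef_trunc // coef_deriv_trunc //.
  by rewrite (leq_ltn_trans _ nN).
have : G.[0] = 0.
  have := congr1 (fun p : {poly K} => p`_(k + j)) EG.
  rewrite coefXM coefXnM ltnn subnn -horner_coef0 => <-.
  by case: eqP => // /eqP; rewrite -lt0n => h; rewrite E0 // prednK.
have -> : G.[0] = u * W1.[0] * T1.[0] * (j%:R - k%:R).
  rewrite /G !(hornerD, hornerN, hornerM, hornerZ, hornerX, hornerC); ring.
have -> : T1.[0] = c j by rewrite horner_coef0 coef_trunc.
move/eqP; rewrite !mulf_eq0 (negPf u0) (negPf W10) (negPf cj) /=.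
by rewrite subr_eq0 eqr_nat => /eqP.
Qed.

(** A function whose expansion at [0] is [w b], with [(1 - X) b' = s b], has
    throughout a domain avoiding [1] the same zeros as [w], with the same
    multiplicities. *)
Lemma continuation_order (D : set C) (H : C -> C) w (s : K) (b c0 : nat -> K)
    (zs : seq K) :
    open D -> connected D -> D 0 -> ~ D 1 ->
    (forall z, D z -> exists c, expands H z c) ->
    expands H 0 c0 -> c0 =1 pmul w b -> c0 0%N != 0 ->
    (forall n, pmul (1 - 'X) (dser b) n = s * b n) ->
    w != 0 -> w = lead_coef w *: \prod_(z <- zs) ('X - z%:P) ->
  forall z, D z -> exists c, [/\ expands H z c,
    forall j, (j < count_mem z zs)%N -> c j = 0 & c (count_mem z zs) != 0].
Proof.
move=> oD cD D0 D1 aH hH0 c0E c00 hb w0 wE z Dz.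
pose p := (1 - 'X) * w; pose q := (1 - 'X) * w^`() + s *: w.
have /choice[cf hcf] : forall z, exists c, D z -> expands H z c.
  move=> y; have [Dy|nDy] := pselect (D y); last by exists (fun=> 0).
  by have [c hc] := aH y Dy; exists c.
(* The linear coefficient [cf x 1] plays the role of the derivative [H' x]. *)
pose E (x : C) : C := p.[x] * cf x 1%N - q.[x] * H x.
have hE y c : D y -> expands H y c ->
    expands E y (pmul (p \Po ('X + y%:P)) (dser c)
                 \+ (fun n => -1 * pmul (q \Po ('X + y%:P)) c n)).
  move=> Dy hc; have := expands_deriv hc; rewrite /expands.
  have : \forall x \near y, D x by exact: open_nbhs_nbhs.
  apply: filterS3 hc => x hx Dx /(_ _ (hcf x Dx)) dx.
  have horner_shift (r : {poly K}) : (r \Po ('X + y%:P)).[x - y] = r.[x].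
    by rewrite horner_comp hornerD hornerX hornerC subrK.
  have -> : E x = p.[x] * cf x 1%N + -1 * (q.[x] * H x) by rewrite mulN1r.
  apply: (@eq_psum _ ((fun n => pmul (p \Po ('X + y%:P)) (dser c) n * (x - y)
    ^+ n)
     \+ (fun n => -1 * (pmul (q \Po ('X + y%:P)) c n * (x - y) ^+ n)))).
    by move=> n /=; rewrite mulrDl mulrA.
  apply: cvg_psumD; last apply: cvg_psumZ; rewrite -[_.[x]]horner_shift.
    exact: cvg_pmul.
  exact: cvg_pmul.
have aE y : D y -> exists c, expands E y c.
  by move=> Dy; have [c hc] := aH y Dy; eexists; exact: hE hc.
have E0 : \forall x \near (0 : C), E x = 0.
  have := hE 0 c0 D0 hH0; apply: filterS => x; apply: series_const0 => n /=.
  rewrite addr0 !comp_polyXr mulN1r.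
  have -> : c0 = pmul w b by apply/funext.
  by rewrite /p /q (pmul_ode _ hb) subrr.
have [c hc] := aH z Dz.
have hode n :
    pmul (p \Po ('X + z%:P)) (dser c) n = pmul (q \Po ('X + z%:P)) c n.
  have := expands_eq0 (hE z c Dz hc) (identity_theorem cD aE D0 E0 Dz) n.
  by move=> /= /eqP; rewrite mulN1r subr_eq0 => /eqP.
have cn0 : exists n, c n != 0.
  have [//|nc] := pselect (exists n, c n != 0).
  have H0 : \forall x \near z, H x = 0.
    apply: filterS hc => x; apply: series_const0 => n.
    by apply/eqP/negPn/negP => cn; apply: nc; exists n.
  have := nbhs_singleton (identity_theorem cD aH Dz H0 D0).
  by rewrite (expands_center hH0) => /eqP; rewrite (negPf c00).
exists c; set k := count_mem z zs.
pose w1 := lead_coef w *: \prod_(y <- zs | y != z) ('X - y%:P).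
have ww1 : w = ('X - z%:P) ^+ k * w1.
  rewrite {1}wE (bigID (pred1 z)) /= scalerAr; congr (_ * _).
  rewrite (eq_bigr (fun=> 'X - z%:P)) => [|y /eqP -> //].
  by rewrite big_const_seq iter_mulr_1.
have W1E : (w1 \Po ('X + z%:P)).[0] != 0.
  rewrite horner_comp hornerD hornerX hornerC add0r hornerZ mulf_neq0
    ?lead_coef_eq0 //.
  rewrite horner_prod prodf_seq_neq0; apply/allP => y _; apply/implyP => yz.
  by rewrite hornerXsubC subr_eq0 eq_sym.
have WE : w \Po ('X + z%:P) = 'X^k * (w1 \Po ('X + z%:P)).
  by rewrite {1}ww1 comp_polyM rmorphXn /= comp_polyB comp_polyX comp_polyC
    addrK.
have u0 : 1 - z != 0.
  by rewrite subr_eq0; apply/eqP => z1; apply: D1; rewrite z1.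
have hode' n : pmul (((1 - z)%:P - 'X) * (w \Po ('X + z%:P))) (dser c) n =
    pmul (((1 - z)%:P - 'X) * (w \Po ('X + z%:P))^`()
          + s *: (w \Po ('X + z%:P))) c n.
  have := hode n; rewrite /p /q !(comp_polyM, comp_polyD, comp_polyZ).
  rewrite raddfN /= comp_polyX comp_polyC.
  rewrite deriv_comp derivD derivX derivC addr0 mulr1.
  by rewrite polyCB opprD addrA addrAC.
rewrite WE in hode'.
by have [ck0 ck] := ode_order u0 W1E hode' cn0; split.
Qed.

End Equation.

Section FormalMap.
Variables (A B : comNzRingType) (f : {rmorphism A -> B}).

Lemma pmul_map (p : {poly A}) (c : nat -> A) n :
  pmul (map_poly f p) (f \o c) n = f (pmul p c n).
Proof.
by rewrite /pmul rmorph_sum; apply: eq_bigr => i _; rewrite coef_map rmorphM.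
Qed.

Lemma dser_map (c : nat -> A) n : dser (f \o c) n = f (dser c n).
Proof. by rewrite /dser rmorphM rmorph_nat. Qed.

End FormalMap.

(** * The hypergeometric series *)

Section Hypergeometric.
Variable R : realType.
Implicit Types (a : R) (F w : {poly R}).

(** The constant term and the zeros determine [F]; a zero [- alpha] contributes
    the factor [1 + alpha^-1 X]. *)
Lemma prod_1DZX m F (alpha : 'I_m -> R) :
    zeros_of F [seq - alpha j | j : 'I_m] -> F.[0] = 1 ->
    (forall j, alpha j != 0) ->
  F = \prod_(b <- [seq (alpha j)^-1 | j : 'I_m]) (1 + b *: 'X).
Proof.
move=> [_ FE] F0 al0; rewrite big_map big_enum /=.
have XE : \prod_(z <- [seq - alpha j | j : 'I_m]) ('X - z%:P) =
   (\prod_j alpha j) *: \prod_j (1 + (alpha j)^-1 *: 'X).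
  rewrite big_map big_enum /= -scaler_prod; apply: eq_bigr => j _.
  by rewrite scalerDr scalerA divff // scale1r alg_polyC polyCN opprK addrC.
have P1 : (\prod_j (1 + (alpha j)^-1 *: 'X)).[0] = 1.
  rewrite horner_prod big1 // => j _.
  by rewrite hornerD hornerZ hornerX hornerC mulr0 addr0.
rewrite XE scalerA in FE; move: F0; rewrite FE hornerZ P1 mulr1 => ->.
exact: scale1r.
Qed.

Lemma zeros_of_real_complex w (rs : seq R) : zeros_of w rs ->
  zeros_of (map_poly (real_complex R) w) [seq r%:C | r <- rs].
Proof.
move=> [w0 wE]; split; first by rewrite map_poly_eq0.
rewrite {1}wE -mul_polyC rmorphM /= map_polyC mul_polyC lead_coef_map; congr (_
  *: _).
rewrite rmorph_prod big_map; apply: eq_bigr => r _.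
by rewrite /= rmorphB /= map_polyX map_polyC.
Qed.

Lemma hyper_branch_zeros m a F w (zs : seq R[i]) :
    F.[0] = 1 -> eulerian m a F w ->
    zeros_of (map_poly (real_complex R) w) zs ->
  forall (D : set (R[i])^o) (H : (R[i])^o -> (R[i])^o),
    hyper_branch a F D H -> zeros_in D H zs.
Proof.
move=> F0 [_ hw] [w0 wE] D H [oD cD [D0 D1] aH H0].
pose f := real_complex R; pose b := f \o binser (m%:R + a).
have c0E n : (hyper_coef a F n)%:C = pmul (map_poly f w) b n.
  by rewrite pmul_map hw.
have c00 : (hyper_coef a F 0)%:C != 0.
  by rewrite fmorph_eq0 /hyper_coef F0 /poch big_ord0 fact0 invr1 !mulr1
    oner_neq0.
have hb n : pmul (1 - 'X) (dser b) n = f (m%:R + a) * b n.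
  have -> : 1 - 'X = map_poly f (1 - 'X) by rewrite rmorphB rmorph1 /=
    map_polyX.
  have -> : dser b = f \o dser (binser (m%:R + a)) by apply/funext => i;
    rewrite dser_map.
  by rewrite pmul_map binser_ode rmorphM.
exact: continuation_order oD cD D0 D1 aH H0 c0E c00 hb w0 wE.
Qed.

End Hypergeometric.

Unset Implicit Arguments.

Theorem theorem3 (R : realType) (m : nat) (a : R) (F w : {poly R})
    (alpha : 'I_m -> R)
    (hm : (1 <= m)%N)
    (hFsize : size F = m.+1)
    (hF0 : F.[0] = 1)
    (hFzeros : zeros_of F [seq - alpha j | j : 'I_m])
    (halpha : forall j : 'I_m, 0 < alpha j)
    (hw : eulerian m a F w) :
  (a + m%:R < 1 ->
    exists rs : seq R,
      [/\ forall r, r \in rs -> 0 < r < 1,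
          zeros_of (map_poly (real_complex R) w) [seq r%:C | r <- rs] &
          forall (D : set (R[i])^o) (H : (R[i])^o -> (R[i])^o),
            hyper_branch a F D H ->
            zeros_in D H [seq r%:C | r <- rs]])
  /\
  (* For m = 1 one has w(x) = 1 - (1 - a / alpha) x, and the claim fails as soon
     as alpha <= a; for m >= 2 one has a < 0 and nothing is required. *)
  (1 <= a + m%:R < 2 ->
   (m = 1%N -> forall j : 'I_m, a < alpha j) ->
    exists (x0 : R) (rs : seq R),
      [/\ forall r, r \in rs -> 0 < r < 1,
          1 <= x0,
          zeros_of (map_poly (real_complex R) w) [seq r%:C | r <- x0 :: rs] &
          forall (D : set (R[i])^o) (H : (R[i])^o -> (R[i])^o),
            hyper_branch a F D H ->
            zeros_in D H [seq r%:C | r <- x0 :: rs]]).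
Proof.
set bs := [seq (alpha j)^-1 | j : 'I_m].
have bs0 : all (fun b => 0 < b) bs.
  by apply/allP => _ /mapP[j _ ->]; rewrite invr_gt0.
have szbs : size bs = m by rewrite size_map size_enum_ord.
have FE : F = \prod_(b <- bs) (1 + b *: 'X).
  by apply: prod_1DZX => // j; rewrite gt_eqF.
have wE : w = eulerian_poly a bs.
  by apply: eulerian_uniq hw _; rewrite FE -szbs; exact: eulerian_polyP.
have zeros rs : zeros_of w rs ->
    zeros_of (map_poly (real_complex R) w) [seq r%:C | r <- rs] /\
    forall (D : set (R[i])^o) (H : (R[i])^o -> (R[i])^o),
      hyper_branch a F D H -> zeros_in D H [seq r%:C | r <- rs].
  move=> /zeros_of_real_complex hz; split=> //.
  exact: hyper_branch_zeros hF0 hw hz.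
split=> [am | /andP[am1 am2] m1].
  have [|rs _ [srt rs1 wrs w0]] := eulerian_poly_roots bs0 (a := a).
    by rewrite szbs.
  have [|hz hH] := zeros rs; last first.
    exists rs; split=> // r r_rs.
    by rewrite (allP (order_path_min lt_trans srt)) // (allP rs1).
  rewrite wE; split=> //.
  by apply: contra_eq_neq w0 => ->; rewrite horner0 eq_sym oner_eq0.
have [x0 [rs [x01 rs01 hz]]] : exists x0 rs,
    [/\ 1 <= x0, all (fun r => 0 < r < 1) rs & zeros_of w (x0 :: rs)].
  have ab b : b \in bs -> b * a < 1.
    case/mapP => j _ ->; rewrite mulrC ltr_pdivrMr // mul1r.
    have [|m_neq1] := eqVneq m 1%N; first by move/m1.
    apply: lt_trans (halpha j); have : 2%:R <= m%:R :> R.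
      by rewrite ler_nat ltn_neqAle eq_sym m_neq1.
    lra.
  case: bs bs0 szbs wE ab {FE} => [|b bs] /=.
    by move=> _ m0; rewrite -m0 in hm.
  move=> /andP[b0 bs0] szbs wE ab.
  have mE : m%:R = (size bs)%:R + 1 :> R by rewrite -szbs -natr1.
  have [|rs szrs hrs] := eulerian_poly_roots bs0 (a := a); first by lra.
  have s0 : 0 <= (size bs)%:R + a by lra.
  have [||x0 [rs' [x01 rs01 w0 wrs]]] := real_simple_01_last_step b0 s0 _ _ hrs.
  - by rewrite szrs addrAC subrr add0r ab // mem_head.
  - by rewrite szrs; have [] := eulerian_polyP a (b :: bs).
  by exists x0, rs'; split=> //; rewrite wE.
have [hzC hH] := zeros _ hz.
by exists x0, rs; split=> // r /(allP rs01).
Qed.
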